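(* Let $(X,d)$ be a bounded, sequentially Yoneda-complete $T_1$ quasi-metric space. Then the map $\phi:\mathcal{K}_0(X)\to\mathbf{C}\mathbf{B}X$, $\phi(K)=K^*$, is a topological embedding of $(\mathcal{K}_0(X),\tau_V)$ into $\mathbf{C}\mathbf{B}X$ equipped with the Scott topology.
   Context: A quasi-metric on $X$ is $d:X\times X\to[0,\infty)$ with $x=y\iff d(x,y)=d(y,x)=0$ and the triangle inequality; $\tau_d$ has base $N_\epsilon(x)=\{y:d(x,y)<\epsilon\}$. $T_1$: $d(x,y)=0\Rightarrow x=y$; bounded: $d$ bounded above. Cauchy sequence: for every $\epsilon>0$ there is $N$ with $d(x_n,x_m)<\epsilon$ for $m\ge n\ge N$; Yoneda limit $x$: $d(x,y)=\inf_n\sup_{m\ge n}d(x_m,y)$ for all $y$; sequentially Yoneda-complete: every Cauchy sequence has a Yoneda limit. $\mathbf{B}X=X\times[0,\infty)$, $(x,r)\prec(y,s)$ iff $d(x,y)<r-s$. $\mathcal{P}_{fin}\mathbf{B}X$: nonempty finite subsets of $\mathbf{B}X$; $F\prec G$ iff every $b\in G$ has $a\in F$ with $a\prec b$ and every $a\in F$ has $b\in G$ with $a\prec b$. An $\omega$-chain is a sequence $(F_n)_{n>0}$ in $\mathcal{P}_{fin}\mathbf{B}X$ with $F_n\prec F_{n+1}$. For $\omega$-chains, $(F_n)\sqsubseteq(G_m)$ iff for every $n$ there is $m$ with $F_n\prec G_m$, and $\sim$ is the associated equivalence (both directions). $\mathbf{C}\mathbf{B}X$ is the set of $\sim$-classes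 ordered by $[(F_n)]\sqsubseteq[(G_m)]$ iff $(F_n)\sqsubseteq(G_m)$; it is a continuous $\omega$-dcpo (ascending sequences have least upper bounds) and its Scott topology is the usual one. $\mathcal{K}_0(X)$: nonempty compact subsets of $(X,\tau_d)$. A standard representation of $K\in\mathcal{K}_0(X)$: for each $n>0$ choose $x^n_1,\dots,x^n_{m_n}\in K$ with every $x\in K$ satisfying $d(x^n_i,x)<\frac1{2n^2}$ for some $i$, and put $F_n=\{(x^k_i,\frac1n):1\le k\le n,1\le i\le m_k\}$; all standard representations of $K$ are $\sim$-equivalent and $K^*$ is their class. The Vietoris topology $\tau_V$ on $\mathcal{K}_0(X)$ is generated by the sets $\{K:K\cap V\neq\emptyset\}$ and $\{K:K\subseteq V\}$ for $V$ $\tau_d$-open. *)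

(* Defs.v *)
From HB Require Import structures.
From mathcomp Require Import all_boot all_order all_algebra.
From mathcomp Require Import finmap generic_quotient.
From mathcomp Require Import boolp classical_sets functions cardinality.
From mathcomp Require Import interval_inference reals ereal topology sequences.
From mathcomp Require Import ring lra.

Set Implicit Arguments.
Unset Strict Implicit.
Unset Printing Implicit Defensive.

Import Order.TTheory GRing.Theory Num.Theory.
Local Open Scope classical_set_scope.
Local Open Scope ring_scope.
Local Open Scope quotient_scope.

Record quasi_metric (R : realType) (X : Type) := QuasiMetric {
  qdist :> X -> X -> R;
  qdist_ge0 : forall x y, 0 <= qdist x y;
  qdist_eq0 : forall x y, x = y <-> (qdist x y = 0 /\ qdist y x = 0);
  qdist_triangle : forall x y z, qdist x z <= qdist x y + qdist y z }.

(* The carrier of the topology tau_d. *)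
Definition qspace (R : realType) (X : choiceType) (d : quasi_metric R X) : Type
  := X.

Section QuasiMetric.
Context (R : realType) (X : choiceType) (d : quasi_metric R X).

Definition qball (x : X) (e : R) : set (qspace d) := [set y | d x y < e].

Definition qball_base : set (set (qspace d)) :=
  [set B | exists x e, 0 < e /\ B = qball x e].

Lemma qdistxx x : d x x = 0.
Proof. by have [/(_ erefl)[]] := qdist_eq0 d x x. Qed.

Let base_cover : \bigcup_(B in qball_base) B = setT.
Proof.
apply/seteqP; split=> // x _; exists (qball x 1); first by exists x, 1.
by rewrite /qball /= qdistxx.
Qed.

Let base_join (A B : set (qspace d)) (t : qspace d) :
  qball_base A -> qball_base B -> A t -> B t ->
  exists C, [/\ qball_base C, C t & C `<=` A `&` B].
Proof.
move=> [x [e [_ ->]]] [y [f [_ ->]]]; rewrite /qball /= => xt yt.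
exists (qball t (Num.min (e - d x t) (f - d y t))); split.
- by exists t; eexists; split; last reflexivity; rewrite lt_min !subr_gt0 xt yt.
- by rewrite /qball /= qdistxx lt_min !subr_gt0 xt yt.
- move=> z; rewrite /qball /= lt_min => /andP[ze zf].
  by have := qdist_triangle d x t z; have := qdist_triangle d y t z; split; lra.
Qed.

HB.instance Definition _ := Choice.copy (qspace d) X.
HB.instance Definition _ :=
  @isBaseTopological.Build (qspace d) (set (qspace d)) qball_base id
    base_cover base_join.

Lemma open_qball (x : X) (e : R) : 0 < e -> open (qball x e).
Proof.
by move=> e0; exists [set qball x e]; rewrite ?bigcup_set1// => _ ->; exists x, e.
Qed.

Lemma open_qspaceP (U : set (qspace d)) :
  open U <-> forall x, U x -> exists2 e : R, 0 < e & qball x e `<=` U.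
Proof.
split=> [[D DB <-] x [B DBx Bx]|oU].
  have [y [e [e0 BE]]] := DB _ DBx; rewrite BE in DBx Bx.
  exists (e - d y x) => [|z xz]; first by rewrite subr_gt0.
  exists (qball y e) => //; move: xz Bx; rewrite /qball /=.
  by have := qdist_triangle d y x z; lra.
rewrite openE => x /oU[e e0 eU]; rewrite /interior nbhsE; exists (qball x e) => //.
by split; [exact: open_qball|rewrite /qball /= qdistxx].
Qed.

Definition bounded_qm : Prop := exists M : R, forall x y : X, d x y <= M.

Definition T1_qm : Prop := forall x y : X, d x y = 0 -> x = y.

Definition qcauchy (u : nat -> X) : Prop :=
  forall e : R, 0 < e ->
    exists N, forall n m, (N <= n)%N -> (n <= m)%N -> d (u n) (u m) < e.

(* esups v n is the supremum of v m over m >= n; the infimum and suprema are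
   taken in the extended reals, where they always exist. *)
Definition yoneda_limit (u : nat -> X) (x : X) : Prop :=
  forall y : X,
    (d x y)%:E = ereal_inf (range (esups (fun m => (d (u m) y)%:E))).

Definition seq_yoneda_complete : Prop :=
  forall u, qcauchy u -> exists x, yoneda_limit u x.

Definition formal_ball : Type := (X * {nonneg R})%type.

Definition fball_prec (a b : formal_ball) : Prop :=
  d a.1 b.1 < a.2%:num - b.2%:num.

Record fin_fballs := FinFballs {
  fball_in :> set formal_ball;
  fball_in_finite : finite_set fball_in;
  fball_in_neq0 : fball_in !=set0 }.

(* The Egli-Milner lifting of the relation on formal balls. *)
Definition fin_prec (F G : fin_fballs) : Prop :=
  (forall b, fball_in G b -> exists2 a, fball_in F a & fball_prec a b) /\
  (forall a, fball_in F a -> exists2 b, fball_in G b & fball_prec a b).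

(* Chains are indexed by positive integers: the term at index n stands for the
   term usually written F_{n+1}. *)
Record omega_chain := OmegaChain {
  chain_fun :> nat -> fin_fballs;
  chain_prec : forall n, fin_prec (chain_fun n) (chain_fun n.+1) }.

HB.instance Definition _ := gen_eqMixin omega_chain.
HB.instance Definition _ := gen_choiceMixin omega_chain.

Definition chain_le (F G : omega_chain) : Prop :=
  forall n, exists m, fin_prec (F n) (G m).

Lemma fball_prec_trans a b c : fball_prec a b -> fball_prec b c -> fball_prec a c.
Proof.
by rewrite /fball_prec => ab bc; have := qdist_triangle d a.1 b.1 c.1; lra.
Qed.

Lemma fin_prec_trans F G H : fin_prec F G -> fin_prec G H -> fin_prec F H.
Proof.
move=> [FG1 FG2] [GH1 GH2]; split=> [c /GH1[b /FG1[a Fa ab] bc]|].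
  by exists a => //; exact: fball_prec_trans bc.
by move=> a /FG2[b /GH2[c Hc bc] ab]; exists c => //; exact: fball_prec_trans bc.
Qed.

Lemma chain_le_refl F : chain_le F F.
Proof. by move=> n; exists n.+1; exact: chain_prec. Qed.

Lemma chain_le_trans F G H : chain_le F G -> chain_le G H -> chain_le F H.
Proof.
move=> FG GH n; have [m FGm] := FG n; have [p GHp] := GH m.
by exists p; exact: fin_prec_trans GHp.
Qed.

Definition chain_equiv (F G : omega_chain) : bool :=
  `[< chain_le F G /\ chain_le G F >].

Lemma chain_equiv_refl : reflexive chain_equiv.
Proof. by move=> F; apply/asboolP; split; exact: chain_le_refl. Qed.

Lemma chain_equiv_sym : symmetric chain_equiv.
Proof. by move=> F G; apply/asboolP/asboolP => -[]. Qed.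

Lemma chain_equiv_trans : transitive chain_equiv.
Proof.
move=> G F H /asboolP[FG GF] /asboolP[GH HG]; apply/asboolP.
by split; [exact: chain_le_trans GH|exact: chain_le_trans GF].
Qed.

Canonical chain_equiv_rel :=
  EquivRel chain_equiv chain_equiv_refl chain_equiv_sym chain_equiv_trans.

Definition CB : Type := {eq_quot chain_equiv_rel}.

HB.instance Definition _ := Choice.on CB.
HB.instance Definition _ := EqQuotient.on CB.

Definition CB_le (u v : CB) : bool := `[< chain_le (repr u) (repr v) >].

Lemma chain_equiv_reprP (F : omega_chain) :
  chain_le (repr (\pi_CB F)) F /\ chain_le F (repr (\pi_CB F)).
Proof.
have : \pi_CB (repr (\pi_CB F)) == \pi_CB F by rewrite reprK.
by rewrite piE => /asboolP.
Qed.

(* The order does not depend on the choice of representatives. *)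
Lemma CB_leE (F G : omega_chain) :
  CB_le (\pi_CB F) (\pi_CB G) = `[< chain_le F G >].
Proof.
have [F1 F2] := chain_equiv_reprP F; have [G1 G2] := chain_equiv_reprP G.
apply/asboolP/asboolP => FG.
  by apply: chain_le_trans F2 _; exact: chain_le_trans G1.
by apply: chain_le_trans F1 _; exact: chain_le_trans G2.
Qed.

Lemma CB_le_refl : reflexive CB_le.
Proof. by move=> u; apply/asboolP; exact: chain_le_refl. Qed.

Lemma CB_le_anti : antisymmetric CB_le.
Proof.
move=> u v /andP[/asboolP uv /asboolP vu].
rewrite -[u]reprK -[v]reprK; apply/eqP.
by rewrite piE; apply/asboolP.
Qed.

Lemma CB_le_trans : transitive CB_le.
Proof.
move=> v u w /asboolP uv /asboolP vw; apply/asboolP.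
exact: chain_le_trans vw.
Qed.

HB.instance Definition _ :=
  Order.Le_isPOrder.Build (Order.Disp tt tt) CB
    CB_le_refl CB_le_anti CB_le_trans.

(* CB is only an omega-dcpo: suprema of arbitrary directed subsets need not
   exist, and Scott openness is defined through ascending sequences. *)
Definition scott_open : set (set CB) :=
  [set U | (forall u v : CB, U u -> (u <= v)%O -> U v) /\
     (forall (s : nat -> CB) (u : CB),
        {homo s : m n / (m <= n)%N >-> (m <= n)%O} ->
        supremums (range s) u -> U u -> exists n, U (s n))].

Let scott_openT : scott_open setT.
Proof. by split=> // s u _ _ _; exists 0%N. Qed.

Let scott_openI : setI_closed scott_open.
Proof.
move=> U V [Uup Usup] [Vup Vsup]; split=> [u v [Uu Vu] uv|].
  by split; [exact: Uup uv|exact: Vup uv].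
move=> s u sh su [/(Usup s u sh su)[m Um] /(Vsup s u sh su)[n Vn]].
exists (maxn m n); split; [apply: Uup Um _|apply: Vup Vn _]; apply: sh.
  exact: leq_maxl.
exact: leq_maxr.
Qed.

Let scott_open_bigU (I : Type) (U : I -> set CB) :
  (forall i, scott_open (U i)) -> scott_open (\bigcup_i U i).
Proof.
move=> oU; split=> [u v [i _ Uiu] uv|s u sh su [i _ Uiu]].
  by exists i => //; exact: (oU i).1 uv.
by have [n Un] := (oU i).2 s u sh su Uiu; exists n, i.
Qed.

HB.instance Definition _ :=
  isOpenTopological.Build CB scott_openT scott_openI scott_open_bigU.

Lemma CB_openE : (open : set (set CB)) = scott_open.
Proof. by []. Qed.

Record K0 := MkK0 {
  K0_in :> set (qspace d);
  K0_neq0 : K0_in !=set0;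
  K0_compact : compact K0_in }.

HB.instance Definition _ := gen_eqMixin K0.
HB.instance Definition _ := gen_choiceMixin K0.

(* The topology of K0 is the Vietoris topology. *)
Definition vietoris_subbase : set (set K0) :=
  [set A | exists2 V : set (qspace d), open V &
     A = [set K : K0 | K `&` V !=set0] \/ A = [set K : K0 | K `<=` V]].

HB.instance Definition _ :=
  @isSubBaseTopological.Build K0 (set K0) vietoris_subbase id.

Lemma open_vietoris_subbase (A : set K0) : vietoris_subbase A -> open A.
Proof.
move=> VA; exists [set A]; last by rewrite bigcup_set1.
move=> _ ->; exists [fset A]%fset; first by move=> ? /fset1P ->; rewrite inE.
by rewrite set_fset1 bigcap_set1.
Qed.

(* As for chains, the index n stands for n+1: x n lists the points chosen at
   stage n+1. *)
Definition standard_rep (K : K0) (F : omega_chain) : Prop :=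
  exists x : nat -> seq X,
    [/\ forall n z, z \in x n -> K0_in K z,
        forall n y, K0_in K y ->
          exists2 z, z \in x n & d z y < (2 * n.+1%:R ^+ 2)^-1 &
        forall n, F n = [set b : formal_ball |
          (exists2 k, (k <= n)%N & b.1 \in x k) /\ b.2%:num = n.+1%:R^-1]
          :> set formal_ball].

Lemma K0_finite_net (K : K0) (e : R) : 0 < e ->
  exists2 s : seq X, (forall z, z \in s -> K0_in K z) &
    (forall y, K0_in K y -> exists2 z, z \in s & d z y < e).
Proof.
move=> e0; have [x0 _] := K0_neq0 K.
pose T : ptopologicalType :=
  HB.pack (qspace d) (isPointed.Build (qspace d) x0).
have : cover_compact (K : set T) by rewrite -compact_cover; exact: K0_compact.
move=> /(_ (qspace d) K (fun x => qball x e))[].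
- by move=> x _; exact: open_qball.
- by move=> y Ky; exists y => //; rewrite /qball /= qdistxx.
move=> D DK KD; exists (enum_fset D) => [z zD|y /KD[z zD zy]].
  by have := DK z zD; rewrite inE.
by exists z.
Qed.

(* Gaps between consecutive radii dominate the precision of the nets. *)
Lemma net_radius_gap (n : nat) :
  (2 * n.+1%:R ^+ 2)^-1 <= n.+1%:R^-1 - n.+2%:R^-1 :> R.
Proof.
have n0 : (0 : R) <= n%:R by exact: ler0n.
have -> : n.+2%:R = n%:R + 2 :> R by rewrite -addn2 natrD.
have -> : n.+1%:R = n%:R + 1 :> R by rewrite -addn1 natrD.
set a : R := n%:R in n0 *.
have -> : (a + 1)^-1 - (a + 2)^-1 = ((a + 1) * (a + 2))^-1.
  by field; apply/andP; split; lra.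
by rewrite lef_pV2 ?posrE; [nra|nra|nra].
Qed.

Lemma standard_rep_exists (K : K0) : exists F, standard_rep K F.
Proof.
have e0 n : 0 < (2 * n.+1%:R ^+ 2)^-1 :> R.
  by rewrite invr_gt0 mulr_gt0// exprn_gt0.
have /choice[x xP] : forall n, exists s : seq X,
    (forall z, z \in s -> K0_in K z) /\
    (forall y, K0_in K y ->
       exists2 z, z \in s & d z y < (2 * n.+1%:R ^+ 2)^-1).
  by move=> n; have [s] := K0_finite_net K (e0 n); exists s.
have r0 n : 0 <= n.+1%:R^-1 :> R by rewrite invr_ge0.
pose r n : {nonneg R} := NngNum (r0 n).
pose A n : set formal_ball := [set b |
  (exists2 k, (k <= n)%N & b.1 \in x k) /\ b.2%:num = n.+1%:R^-1].
have Afin n : finite_set (A n).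
  apply: (@sub_finite_set _ _
    [set` [seq (z, r n) | z <- flatten [seq x k | k <- iota 0 n.+1]]]).
    move=> [z s] [[k kn zk] sE]; have -> : s = r n by exact/val_inj.
    apply: map_f; apply/flatten_mapP; exists k => //.
    by rewrite mem_iota.
  exact: finite_seq.
have A0 n : A n !=set0.
  have [y Ky] := K0_neq0 K; have [z zx _] := (xP n).2 y Ky.
  by exists (z, r n); split => //; exists n.
pose B n := FinFballs (Afin n) (A0 n).
have gap n : 0 < n.+1%:R^-1 - n.+2%:R^-1 :> R.
  exact: lt_le_trans (e0 n) (net_radius_gap n).
have AB n : fin_prec (B n) (B n.+1).
  split=> [[z s] [[k /= kn zk] sE]|[z s] [[k /= kn zk] sE]]; last first.
    exists (z, r n.+1); first by split=> //; exists k => //; exact: leqW.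
    by rewrite /fball_prec/= sE qdistxx.
  have [w wx wz] := (xP n).2 z ((xP k).1 z zk).
  exists (w, r n); first by split=> //; exists n.
  by rewrite /fball_prec/= sE; exact: lt_le_trans wz (net_radius_gap n).
exists (OmegaChain AB), x; split=> //; by move=> n; case: (xP n).
Qed.

Definition Kstar (K : K0) : CB := \pi_CB (projT1 (cid (standard_rep_exists K))).

Lemma Kstar_standard_rep (K : K0) :
  exists2 F, standard_rep K F & Kstar K = \pi_CB F.
Proof. by rewrite /Kstar; case: cid => F; exists F. Qed.

Lemma standard_rep_approx (K : K0) (x : nat -> seq X) (z : X) (e : R) :
  T1_qm ->
  (forall n z, z \in x n -> K0_in K z) ->
  (forall n y, K0_in K y ->
     exists2 z, z \in x n & d z y < (2 * n.+1%:R ^+ 2)^-1) ->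
  K0_in K z -> 0 < e -> exists k, exists2 y, y \in x k & d z y < e.
Proof.
move=> T1 xK xnet Kz e0; apply: contrapT => far.
have /choice[y yP] : forall k, exists y,
    y \in x k /\ d y z < (2 * k.+1%:R ^+ 2)^-1.
  by move=> k; have [y ? ?] := xnet k z Kz; exists y.
have [w [Kw wcl]] : exists w, K0_in K w /\ cluster ((y : nat -> qspace d) @ \oo) w.
  have [|w [Kw wcl]] := @K0_compact K ((y : nat -> qspace d) @ \oo) _.
    by exists 0%N => // k _; exact: (xK k _ (yP k).1).
  by exists w.
have freq f N : 0 < f -> exists2 k, (N <= k)%N & d w (y k) < f.
  move=> f0; have [] := wcl [set u | exists2 k, (N <= k)%N & u = y k] (qball w f).
  - by exists N => // k /= Nk; exists k.
  - apply: open_nbhs_nbhs; split; first exact: open_qball.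
    by rewrite /qball /= qdistxx.
  - by move=> _ [[k Nk ->] wk]; exists k.
have wz : w = z.
  apply: T1; apply/eqP; rewrite eq_le qdist_ge0 andbT; apply/ler_addgt0Pr => f f0.
  rewrite add0r; have f2 : 0 < f / 2 by lra.
  have [k Nk wk] := freq (f / 2) (Num.truncn (f / 2)^-1) f2.
  apply: le_trans (qdist_triangle d w (y k) z) _.
  suff : d (y k) z < f / 2 by lra.
  apply: lt_le_trans (yP k).2 _; rewrite -[leRHS]invrK lef_pV2 ?posrE; last 2 first.
  - by rewrite mulr_gt0// exprn_gt0.
  - by rewrite invr_gt0.
  apply: (@le_trans _ _ k.+1%:R).
    apply: le_trans (ltW (truncnS_gt _)) _.
    by rewrite ler_nat.
  have k1 : 1 <= k.+1%:R :> R by rewrite ler1n.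
  by set t : R := k.+1%:R in k1 *; nra.
have [k _ wk] := freq e 0%N e0; apply: far; exists k; exists (y k).
  exact: (yP k).1.
by rewrite -wz.
Qed.

Lemma standard_rep_le (K : K0) (F G : omega_chain) :
  T1_qm -> standard_rep K F -> standard_rep K G -> chain_le F G.
Proof.
move=> T1 [x [xK xnet FE]] [y [yK ynet GE]] n.
have e0 : 0 < (2 * n.+1%:R)^-1 :> R by rewrite invr_gt0 mulr_gt0.
have /choice[k kP] : forall z, exists k, K0_in K z ->
    exists2 w, w \in y k & d z w < (2 * n.+1%:R)^-1.
  move=> z; have [Kz|] := pselect (K0_in K z); last by exists 0%N.
  by have [k kP] := standard_rep_approx T1 yK ynet Kz e0; exists k.
pose s := flatten [seq x j | j <- iota 0 n.+1].
pose m := maxn (\max_(z <- s) k z) n.*2.+1.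
have gap : (2 * n.+1%:R)^-1 <= n.+1%:R^-1 - m.+1%:R^-1 :> R.
  have le_m : m.+1%:R^-1 <= (2 * n.+1%:R)^-1 :> R.
    rewrite lef_pV2 ?posrE ?mulr_gt0// -natrM ler_nat mul2n doubleS ltnS.
    exact: leq_maxr.
  have half : n.+1%:R^-1 = (2 * n.+1%:R)^-1 + (2 * n.+1%:R)^-1 :> R.
    by rewrite invfM mulrC -splitr.
  by rewrite half -addrA lerDl subr_ge0.
have rK p : 0 <= p.+1%:R^-1 :> R by rewrite invr_ge0.
exists m; split=> -[z r]; rewrite FE GE => -[[j /= jm zj] rE].
  have [w wx wz] := xnet n z (yK _ _ zj).
  exists (w, NngNum (rK n)); first by split=> //; exists n.
  rewrite /fball_prec /= rE; apply: lt_le_trans wz _; apply: le_trans gap.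
  rewrite lef_pV2 ?posrE ?mulr_gt0// ?exprn_gt0//.
  have n1 : 1 <= n.+1%:R :> R by rewrite ler1n.
  by set t : R := n.+1%:R in n1 *; nra.
have [w wy zw] := kP z (xK _ _ zj).
have kzm : (k z <= m)%N.
  rewrite leq_max; apply/orP; left; apply: leq_bigmax_seq => //.
  by apply/flatten_mapP; exists j => //; rewrite mem_iota.
exists (w, NngNum (rK m)); first by split=> //; exists (k z).
by rewrite /fball_prec /= rE; exact: lt_le_trans gap.
Qed.

(* Over a T1 space, K^* is the class of any standard representation of K. *)
Lemma Kstar_eq (K : K0) (F : omega_chain) :
  T1_qm -> standard_rep K F -> Kstar K = \pi_CB F.
Proof.
move=> T1 KF; have [G KG ->] := Kstar_standard_rep K; apply/eqP; rewrite piE.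
by apply/asboolP; split; [exact: standard_rep_le T1 KG KF|exact: standard_rep_le T1 KF KG].
Qed.

End QuasiMetric.

(* f is a homeomorphism onto its range with the subspace topology. *)
Definition topological_embedding (S T : topologicalType) (f : S -> T) : Prop :=
  [/\ injective f, continuous f &
      forall U : set S, open U -> exists2 V : set T, open V &
        f @` U = V `&` range f].

(* Main.v *)
Require Import Defs.
From mathcomp Require Import all_boot all_order all_algebra.
From mathcomp Require Import finmap.
From mathcomp Require Import boolp cardinality.
From mathcomp Require Import interval_inference normedtype.
From mathcomp Require Import classical_sets reals topology.
From mathcomp Require Import lra.

(* For a finite set G of formal balls let way_above G be the set of classes of
   chains that eventually lie above G. These sets are Scott open, and every
   Scott neighbourhood of [(F_n)] contains some way_above (F_n), because
   [(F_n)] is the supremum of the classes of the chains (F_n + 1/k)_k.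
   Moreover K^* lies in way_above G exactly when the balls of G, shrunk by some
   e > 0, cover K, and each ball of G meets K. The first condition on K is
   open of the kind "K is contained in V" and the second of the kind "K meets
   V", which gives continuity. Conversely, taking for G a finite net of K with
   all radii equal to e, every L with L^* in way_above G lies in the
   e-neighbourhood of K and meets the e-balls around the chosen points; this
   gives openness onto the range, and then injectivity since a T1 space
   separates a compact set from a point outside it by an open superset. *)

Set Implicit Arguments.
Unset Strict Implicit.
Unset Printing Implicit Defensive.

Import Order.TTheory GRing.Theory Num.Theory.
Local Open Scope classical_set_scope.
Local Open Scope ring_scope.
Local Open Scope quotient_scope.

Lemma filter_finite_bigcap (T : Type) (I : choiceType) (F : set_system T)
    (A : set I) (f : I -> set T) : Filter F -> finite_set A ->
  (forall i, A i -> F (f i)) -> F (\bigcap_(i in A) f i).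
Proof.
by move=> FF /finite_fsetP[D ->] Ff; apply: filter_bigI => i; exact: Ff.
Qed.

Section Embedding.
Context (R : realType) (X : choiceType) (d : quasi_metric R X).
Implicit Types (F G H : fin_fballs R X) (C : omega_chain d) (K L : K0 d).

(** * Chains, their classes and the sets [way_above G] *)

Lemma chain_fin_prec C m n : (m < n)%N -> fin_prec d (C m) (C n).
Proof.
elim: n => // n IH; rewrite ltnS leq_eqVlt => /orP[/eqP ->|/IH mn].
  exact: chain_prec.
by apply: fin_prec_trans mn _; exact: chain_prec.
Qed.

Lemma fin_prec_chain_leq G C m n : (m <= n)%N ->
  fin_prec d G (C m) -> fin_prec d G (C n).
Proof.
rewrite leq_eqVlt => /orP[/eqP <- //|mn GC].
by apply: fin_prec_trans GC _; exact: chain_fin_prec.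
Qed.

(** Phrased with the chosen representative; [way_above_pi] shows that any chain of the class
    serves. *)
Definition way_above G : set (CB d) :=
  [set u : CB d | exists m, fin_prec d G ((repr u : omega_chain d) m)].

Lemma pi_leP C (u : CB d) : (\pi_(CB d) C <= u)%O <-> chain_le C (repr u).
Proof.
have -> : (\pi_(CB d) C <= u)%O = CB_le (\pi_(CB d) C) (\pi_(CB d) (repr u)).
  by rewrite reprK.
by rewrite CB_leE; split=> /asboolP.
Qed.

Lemma pi_le C C' : (\pi_(CB d) C <= \pi_(CB d) C')%O <-> chain_le C C'.
Proof.
have [C1 C2] := chain_equiv_reprP C'.
by rewrite pi_leP; split=> CC'; exact: chain_le_trans CC' _.
Qed.

Lemma way_above_pi G C :
  way_above G (\pi_(CB d) C) <-> exists m, fin_prec d G (C m).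
Proof.
have [C1 C2] := chain_equiv_reprP C; split=> -[m Gm].
  by have [n Cn] := C1 m; exists n; exact: fin_prec_trans Cn.
by have [n Cn] := C2 m; exists n; exact: fin_prec_trans Cn.
Qed.

(* The diagonal chain takes as its k-th term a late enough term of the chain
   representing s k. *)
Lemma diagonal_upper_bound (s : nat -> CB d) :
  {homo s : m n / (m <= n)%N >-> (m <= n)%O} ->
  exists2 C : omega_chain d,
    (forall k, exists m, C k = repr (s k) m) & ubound (range s) (\pi_(CB d) C).
Proof.
move=> sh.
have /choice[N NP] : forall jik : nat * nat * nat, exists m,
    (jik.1.1 <= jik.2)%N ->
    fin_prec d (repr (s jik.1.1) jik.1.2) (repr (s jik.2) m).
  move=> [[j i] k] /=; have [jk|] := boolP (j <= k)%N; last by exists 0%N.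
  by have /asboolP/(_ i)[m ?] := sh _ _ jk; exists m.
(* The maximum over [j < k] puts term [m k] of [s k] above terms of all earlier chains. Passing
   [m k'] makes the diagonal a chain; passing [k'] makes it overtake every fixed index. *)
pose m := fix m k := if k is k'.+1 then
  \max_(j < k) N (val j, maxn k' (m k'), k) else 0%N.
have mP j i k : (j <= k)%N -> (i <= k)%N || (i <= m k)%N ->
    fin_prec d (repr (s j) i) (repr (s k.+1) (m k.+1)).
  move=> jk ik.
  have : fin_prec d (repr (s j) (maxn k (m k))) (repr (s k.+1) (m k.+1)).
    rewrite -ltnS in jk.
    apply: fin_prec_chain_leq (NP (j, maxn k (m k), k.+1) (ltnW jk)).
    exact: (@leq_bigmax _ (fun j : 'I_k.+1 => N (val j, maxn k (m k), k.+1))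
      (Ordinal jk)).
  have : (i <= maxn k (m k))%N by rewrite leq_max.
  rewrite leq_eqVlt => /orP[/eqP <- //|im]; apply: fin_prec_trans.
  exact: chain_fin_prec.
have CP k : fin_prec d (repr (s k) (m k)) (repr (s k.+1) (m k.+1)).
  by apply: mP; rewrite ?leqnn ?orbT.
exists (OmegaChain CP) => [k|_ [j _ <-]]; first by exists (m k).
rewrite -[s j]reprK; apply/pi_le => i; exists (maxn j i).+1.
by apply: mP; rewrite ?leq_maxl ?leq_maxr.
Qed.

(** The supremum of [s] lies below the class of a diagonal chain, so [G] precedes a term of that
    chain, which is itself a term of a chain representing some [s k]. *)
Lemma open_way_above G : open (way_above G).
Proof.
rewrite CB_openE; split=> [u v [m Gm] /asboolP/(_ m)[n mn]|s u sh [_ ulb]].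
  by exists n; exact: fin_prec_trans mn.
move=> [m Gm]; have [C Cs /ulb/asboolP/(_ m)[n]] := diagonal_upper_bound sh.
have [C1 _] := chain_equiv_reprP C; have [k nk] := C1 n.
have [p Cp] := Cs k; rewrite Cp in nk => mn.
exists k, p; apply: fin_prec_trans Gm _; exact: fin_prec_trans nk.
Qed.

(** * Enlarged chains and Scott neighbourhoods *)

Definition enlarge_ball (e : {nonneg R}) (b : formal_ball R X) :
  formal_ball R X := (b.1, (b.2%:num + e%:num)%:nng).

Definition enlarge G (e : {nonneg R}) : fin_fballs R X :=
  FinFballs (finite_image (enlarge_ball e) (@fball_in_finite _ _ G))
    (image_nonempty (enlarge_ball e) (@fball_in_neq0 _ _ G)).

Lemma fin_prec_enlarge G (e f : {nonneg R}) : f%:num < e%:num ->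
  fin_prec d (enlarge G e) (enlarge G f).
Proof.
move=> fe; split=> _ [b Gb <-].
  exists (enlarge_ball e b); first by exists b.
  by rewrite /fball_prec /= qdistxx; lra.
exists (enlarge_ball f b); first by exists b.
by rewrite /fball_prec /= qdistxx; lra.
Qed.

Lemma fin_prec_enlarge_id G (e : {nonneg R}) : 0 < e%:num ->
  fin_prec d (enlarge G e) G.
Proof.
move=> e0; split=> [b Gb|_ [b Gb <-]].
  exists (enlarge_ball e b); first by exists b.
  by rewrite /fball_prec /= qdistxx; lra.
by exists b => //; rewrite /fball_prec /= qdistxx; lra.
Qed.

Definition enlarge_seq G n : fin_fballs R X := enlarge G (n.+1%:R^-1)%:nng.

Lemma enlarge_seq_prec G n :
  fin_prec d (enlarge_seq G n) (enlarge_seq G n.+1).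
Proof. by apply: fin_prec_enlarge; rewrite /= ltf_pV2 ?posrE// ltr_nat. Qed.

Definition enlarge_chain G : omega_chain d := OmegaChain (enlarge_seq_prec G).

(** Strict inequalities survive a small increase of the radii in [H]; since [G] and [H] are finite,
    one index serves all their balls. *)
Lemma fin_prec_enlarge_chain G H :
  fin_prec d G H -> exists n, fin_prec d G (enlarge_chain H n).
Proof.
move=> [GH1 GH2].
have prec_near a b : fball_prec d a b ->
    \forall n \near \oo, fball_prec d a (enlarge_ball (n.+1%:R^-1)%:nng b).
  rewrite /fball_prec -subr_gt0 => ab.
  near=> n; rewrite /=; suff : n.+1%:R^-1 < a.2%:num - b.2%:num - d a.1 b.1
    by move: (n.+1%:R^-1) => t; lra.
  by near: n; exact: (near_infty_natSinv_lt (PosNum ab)).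
have near1 : \forall n \near \oo, (\bigcap_(b in H) [set n |
    exists2 a, fball_in G a & fball_prec d a (enlarge_ball (n.+1%:R^-1)%:nng b)]) n.
  apply: filter_finite_bigcap; first exact: fball_in_finite.
  move=> b /GH1[a Ga /prec_near ab]; apply: filterS ab => n ab.
  by exists a.
have near2 : \forall n \near \oo, (\bigcap_(a in G) [set n |
    exists2 b, fball_in H b & fball_prec d a (enlarge_ball (n.+1%:R^-1)%:nng b)]) n.
  apply: filter_finite_bigcap; first exact: fball_in_finite.
  move=> a /GH2[b Hb /prec_near ab]; apply: filterS ab => n ab.
  by exists b.
have [n [n1 n2]] := filter_ex (filterI near1 near2).
exists n; split=> [_ [b Hb <-]|a Ga]; first exact: n1.
by have [b Hb ab] := n2 a Ga; exists (enlarge_ball (n.+1%:R^-1)%:nng b) => //; exists b.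
Unshelve. all: by end_near.
Qed.

(** Leastness: the relation from [C n] to [C n.+1] leaves room for an enlargement of [C n.+1], so a
    bound of all enlarged chains dominates each [C n]. *)
Lemma supremums_enlarge_chain C :
  supremums (range (fun n => \pi_(CB d) (enlarge_chain (C n)))) (\pi_(CB d) C).
Proof.
have below G k : fin_prec d (enlarge_chain G k) G.
  by apply: fin_prec_enlarge_id; rewrite /= invr_gt0.
split=> [_ [n _ <-]|u uub].
  by apply/pi_le => k; exists n.
apply/pi_leP => n.
have [k nk] := fin_prec_enlarge_chain (chain_prec C n).
have /pi_leP/(_ k)[m km] : (\pi_(CB d) (enlarge_chain (C n.+1)) <= u)%O.
  by apply: uub; exists n.+1.
by exists m; exact: fin_prec_trans nk km.
Qed.

(** By the supremum above, [U] contains the class of some [enlarge_chain (C n)], and that class lies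
    below every element of [way_above (C n)]. *)
Lemma open_way_above_sub (U : set (CB d)) C : open U -> U (\pi_(CB d) C) ->
  exists n, way_above (C n) `<=` U.
Proof.
rewrite CB_openE => -[Uup Usup] UC.
have homoC : {homo (fun n => \pi_(CB d) (enlarge_chain (C n))) :
    m n / (m <= n)%N >-> (m <= n)%O}.
  move=> m n; rewrite leq_eqVlt => /orP[/eqP -> //|mn].
  apply/pi_le => k.
  apply: fin_prec_enlarge_chain; apply: fin_prec_trans (chain_fin_prec C mn).
  by apply: fin_prec_enlarge_id; rewrite /= invr_gt0.
have [n Un] := Usup _ _ homoC (supremums_enlarge_chain C) UC.
exists n => u [m num]; apply: Uup Un _.
apply/pi_leP => k; exists m; apply: fin_prec_trans num.
by apply: fin_prec_enlarge_id; rewrite /= invr_gt0.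
Qed.

(** * Continuity *)

Section T1.
Hypothesis d_T1 : T1_qm d.

Lemma way_above_Kstar G K : way_above G (Kstar K) <->
  (exists2 e, 0 < e &
     forall y, K0_in K y -> exists2 a, fball_in G a & d a.1 y < a.2%:num - e) /\
  (forall a, fball_in G a -> exists2 y, K0_in K y & d a.1 y < a.2%:num).
Proof.
have [C [x [xK xnet CE]] ->] := Kstar_standard_rep K.
have rK n : 0 <= n.+1%:R^-1 :> R by rewrite invr_ge0.
rewrite way_above_pi; split=> [[n [GC1 GC2]]|[[e e0 Ge] GK]].
  split; last first.
    move=> a /GC2[b]; rewrite CE => -[[k _ bk] bn]; rewrite /fball_prec bn => ab.
    by exists b.1; [exact: xK bk|move: (rK n) ab; move: (n.+1%:R^-1) => t; lra].
  (* The gap between the radii at stages [n] and [n.+1] absorbs the precision of the [n]-th net,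
     leaving the shrinkage 1/(n+2). *)
  exists n.+2%:R^-1 => [|y /(xnet n)[z zn zy]]; first by rewrite invr_gt0.
  have [|a Ga] := GC1 (z, NngNum (rK n)).
    by rewrite CE; split=> //; exists n.
  rewrite /fball_prec /= => az; exists a => //.
  move: (net_radius_gap R n) zy az (qdist_triangle d a.1 z y).
  by move: (n.+1%:R^-1) (n.+2%:R^-1) (_^-1) => t u v; lra.
have near1 : \forall n \near \oo, forall a, fball_in G a ->
    exists2 b, fball_in (C n) b & fball_prec d a b.
  apply: (filter_finite_bigcap (f := fun a => [set n |
    exists2 b, fball_in (C n) b & fball_prec d a b])); first exact: fball_in_finite.
  move=> a /GK[y Ky]; rewrite -subr_gt0 => ay.
  have ay2 : 0 < (a.2%:num - d a.1 y) / 2 by lra.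
  (* The nets only make d(z,y) small; the reverse distance d(y,z) needed here comes from compactness
     and T1. The point [z] is kept at all stages from [k] on. *)
  have [k [z zk yz]] := standard_rep_approx d_T1 xK xnet Ky ay2.
  near=> n; exists (z, NngNum (rK n)).
    by rewrite CE; split=> //; exists k => //; near: n; exact: nbhs_infty_ge.
  rewrite /fball_prec /=; have := qdist_triangle d a.1 y z.
  suff : n.+1%:R^-1 < (a.2%:num - d a.1 y) / 2.
    by move: (n.+1%:R^-1) => t; lra.
  by near: n; exact: (near_infty_natSinv_lt (PosNum ay2)).
have near2 := near_infty_natSinv_lt (PosNum e0).
have [n [n1 /= n2]] := filter_ex (filterI near1 near2).
exists n; split=> // b; rewrite CE => -[[k _ /xK/Ge[a Ga ab]] bn].
by exists a => //; rewrite /fball_prec bn; move: n2 ab; move: (n.+1%:R^-1) => t; lra.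
Unshelve. all: by end_near.
Qed.

Lemma open_preimage_way_above G : open ((@Kstar _ _ d) @^-1` way_above G).
Proof.
(* The shrunk radius [a.2 - e] may be nonpositive; the ball is then empty. *)
have oball x e : open (@qball _ _ d x e).
  have [e0|e0] := ltP 0 e; first exact: open_qball.
  suff -> : @qball _ _ d x e = set0 by exact: open0.
  apply/seteqP; split=> // y; rewrite /qball /=.
  by have := qdist_ge0 d x y; lra.
have -> : (@Kstar _ _ d) @^-1` way_above G =
    \bigcup_(e in [set e : R | 0 < e]) [set K : K0 d |
      K `<=` \bigcup_(a in G) @qball _ _ d a.1 (a.2%:num - e)] `&`
    \bigcap_(a in G) [set K : K0 d | K `&` @qball _ _ d a.1 a.2%:num !=set0].
  apply/seteqP; split=> [K /way_above_Kstar[[e e0 Ge] GK]|K [[e e0 Ge] GK]].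
    split; first by exists e => // y /Ge[a Ga ay]; exists a.
    by move=> a /GK[y Ky ay]; exists y.
  apply/way_above_Kstar; split; first by exists e => // y /Ge[a Ga ay]; exists a.
  by move=> a /GK[y [Ky ay]]; exists y.
apply: openI.
  apply: bigcup_open => e _; apply: open_vietoris_subbase.
  exists (\bigcup_(a in G) @qball _ _ d a.1 (a.2%:num - e)); last by right.
  by apply: bigcup_open => a _; exact: oball.
rewrite openE => K GK; apply: filter_finite_bigcap.
  exact: fball_in_finite.
move=> a Ga; apply: open_nbhs_nbhs; split; last exact: GK.
by apply: open_vietoris_subbase; exists (@qball _ _ d a.1 a.2%:num) => //; left.
Qed.

Lemma continuous_Kstar : continuous (@Kstar _ _ d).
Proof.
apply/continuousP => U oU; rewrite openE => K UK.
have [C _ KC] := Kstar_standard_rep K; rewrite /= KC in UK.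
have [n nU] := open_way_above_sub oU UK.
rewrite /interior nbhsE; exists ((@Kstar _ _ d) @^-1` way_above (C n)).
  split; first exact: open_preimage_way_above.
  by rewrite /= KC way_above_pi; exists n.+1; exact: chain_prec.
by move=> L /nU.
Qed.

(** * Openness onto the range *)

Lemma Kstar_nbhd K (x : X) (e : R) : K0_in K x -> 0 < e ->
  exists G, [/\ way_above G (Kstar K),
    forall L y, way_above G (Kstar L) -> K0_in L y -> exists2 z, K0_in K z & d z y < e &
    forall L, way_above G (Kstar L) -> exists2 y, K0_in L y & d x y < e].
Proof.
move=> Kx e0; have e2 : 0 < e / 2 by lra.
(* An e/2-net with radii e leaves a uniform shrinkage e/2; [x] is added as a centre so that L must
   meet its ball. *)
have [s sK snet] := K0_finite_net K e2.
pose r : {nonneg R} := NngNum (ltW e0).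
have A0 : [set` [seq (z, r) | z <- x :: s]] !=set0.
  by exists (x, r); rewrite /= inE eqxx.
pose G : fin_fballs R X := FinFballs (finite_seq [seq (z, r) | z <- x :: s]) A0.
have GP (b : formal_ball R X) : fball_in G b -> K0_in K b.1 /\ b.2%:num = e.
  by move=> /mapP[z]; rewrite inE => /orP[/eqP ->|/sK Kz] ->.
exists G; split.
- apply/way_above_Kstar; split.
    exists (e / 2) => // y /snet[z zs zy]; exists (z, r); last by rewrite /=; lra.
    by apply/mapP; exists z; rewrite ?inE ?zs ?orbT.
  by move=> b /GP[Kb ->]; exists b.1 => //; rewrite qdistxx.
- move=> L y /way_above_Kstar[[f f0 Gf] _] /Gf[b /GP[Kb ->] bye].
  by exists b.1 => //; lra.
- move=> L /way_above_Kstar[_ /(_ (x, r))]; apply.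
  by rewrite /= inE eqxx.
Qed.

(** Otherwise points of K at distance less than 1/(n+1) from points outside V would cluster at some
    w in K, and the triangle inequality would put such an outside point in a ball around w contained
    in V. *)
Lemma compact_uniform_nbhd K (V : set (qspace d)) : open V -> K `<=` V ->
  exists2 e : R, 0 < e & forall x y, K0_in K x -> d x y < e -> V y.
Proof.
move=> /open_qspaceP oV KV; apply: contrapT => bad.
have /choice[xy xyP] : forall n, exists xy : X * X,
    [/\ K0_in K xy.1, d xy.1 xy.2 < n.+1%:R^-1 & ~ V xy.2].
  move=> n; apply: contrapT => nxy; apply: bad.
  exists n.+1%:R^-1 => [|x y Kx xyn]; first by rewrite invr_gt0.
  by apply: contrapT => Vy; apply: nxy; exists (x, y).
pose x n : qspace d := (xy n).1.
have [w [Kw wcl]] : exists w, K0_in K w /\ cluster (x @ \oo) w.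
  have [|w [Kw wcl]] := @K0_compact _ _ _ K (x @ \oo) _; last by exists w.
  by exists 0%N => // n _; have [] := xyP n.
have [e e0 wV] := oV w (KV w Kw); have e2 : 0 < e / 2 by lra.
have [N _ Ne] := near_infty_natSinv_lt (PosNum e2).
have [_ [[n Nn <-] wn]] : [set x n | n in [set n | (N <= n)%N]] `&`
    @qball _ _ d w (e / 2) !=set0.
  apply: wcl; first by exists N => // n Nn; exists n.
  apply: open_nbhs_nbhs; split; first exact: open_qball.
  by rewrite /qball /= qdistxx.
have [_ xyn] := xyP n; apply; apply: wV; rewrite /qball /=.
move: (Ne n Nn) wn xyn (qdist_triangle d w (x n) (xy n).2).
by rewrite /qball /x /=; move: (n.+1%:R^-1) => t; lra.
Qed.

Lemma Kstar_subbase_nbhd (A : set (K0 d)) K : vietoris_subbase A -> A K ->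
  exists G, way_above G (Kstar K) /\ (@Kstar _ _ d) @^-1` way_above G `<=` A.
Proof.
move=> [V oV [->|->]] /=; last first.
  move=> KV; have [e e0 eV] := compact_uniform_nbhd oV KV.
  have [x Kx] := K0_neq0 K; have [G [GK near_K _]] := Kstar_nbhd Kx e0.
  by exists G; split=> // L GL y /(near_K _ _ GL)[z Kz /(eV z y Kz)].
move=> [x [Kx Vx]]; have [e e0 eV] := (open_qspaceP V).1 oV x Vx.
have [G [GK _ meets]] := Kstar_nbhd Kx e0.
by exists G; split=> // L /meets[y Ly xy]; exists y; split=> //; exact: eV.
Qed.

(** A basic Vietoris open set is a finite intersection of subbasic ones, so finitely many sets
    [way_above G] are intersected. *)
Lemma Kstar_open_nbhd (U : set (K0 d)) K : open U -> U K ->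
  exists W : set (CB d),
    [/\ open W, W (Kstar K) & (@Kstar _ _ d) @^-1` W `<=` U].
Proof.
move=> [D DU <-] [A DA AK]; have [E EV EA] := DU A DA.
have /choice[G GP] : forall B : set (K0 d), exists G, B \in E ->
    way_above G (Kstar K) /\ (@Kstar _ _ d) @^-1` way_above G `<=` B.
  move=> B; have [BE|_] := boolP (B \in E); last first.
    (* An arbitrary value for [B] outside [E]. *)
    by have [G _] := K0_neq0 K; exists (enlarge_seq (chain_fun (repr (Kstar K)) 0%N) 0).
  have [||G GB] := @Kstar_subbase_nbhd B K; last by exists G.
  - by have := EV B BE; rewrite inE.
  - by move: AK; rewrite -EA; apply.
exists (\bigcap_(B in [set` E]) way_above (G B)); split.
- rewrite openE => u uW; apply: filter_bigI => B BE.
  by apply: open_nbhs_nbhs; split; [exact: open_way_above|exact: uW].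
- by move=> B /GP[].
- move=> L LW; exists A => //; change (A L); rewrite -EA => B BE.
  by apply: (GP B BE).2; exact: LW.
Qed.

(** * Injectivity and the embedding *)

Lemma open_setC1 (x : X) : open (~` [set x] : set (qspace d)).
Proof.
apply/open_qspaceP => y yx; exists (d y x); last first.
  by move=> z; rewrite /qball /= => yz zx; move: yz; rewrite zx ltxx.
by rewrite lt_neqAle qdist_ge0 andbT; apply/eqP => /esym/d_T1.
Qed.

Lemma Kstar_inj : injective (@Kstar _ _ d).
Proof.
have sub K L : Kstar K = Kstar L -> L `<=` K.
  move=> KL x Lx; apply: contrapT => Kx.
  have oA : open [set M : K0 d | M `<=` ~` [set x]].
    apply: open_vietoris_subbase; exists (~` [set x]); last by right.
    exact: open_setC1.
  have [|W [_ WK WA]] := Kstar_open_nbhd oA (K := K).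
    by move=> y Ky yx; apply: Kx; rewrite -yx.
  have WL : W (Kstar L) by rewrite -KL.
  by have /(_ erefl) := WA L WL x Lx.
move=> K L KL; have : K0_in K = K0_in L.
  by apply/seteqP; split; apply: sub.
case: K L {KL} => [A A0 Ac] [B B0 Bc] /= AB; rewrite AB in A0 Ac *.
by congr MkK0; exact: Prop_irrelevance.
Qed.

End T1.
End Embedding.

Theorem theorem3p9 (R : realType) (X : choiceType) (d : quasi_metric R X)
    (d_bounded : bounded_qm d) (d_complete : seq_yoneda_complete d)
    (d_T1 : T1_qm d) :
  topological_embedding (fun K : K0 d => Kstar K : CB d).
Proof.
split=> [||U oU]; [exact: Kstar_inj|exact: continuous_Kstar|].
(* The largest Scott open set whose preimage lies in [U]. *)
exists (\bigcup_(W in [set W : set (CB d) | open W /\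
  (@Kstar _ _ d) @^-1` W `<=` U]) W).
  by apply: bigcup_open => W [oW _].
apply/seteqP; split=> [_ [K UK <-]|u [[W [_ WU] WK] [K _ KE]]].
  have [W [oW WK WU]] := Kstar_open_nbhd d_T1 oU UK.
  by split; [exists W|exists K].
by exists K => //; apply: WU; rewrite /= KE.
Qed.
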